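(* The series $$\sum_{n=-\infty}^{+\infty}\frac{1}{\left(n+\frac12\right)^3}$$ converges to zero (hence to an algebraic number).
   Context: The bilateral series is over all $n\in\mathbb{Z}$. *)

(* Defs.v *)
From mathcomp Require Import all_boot all_order all_algebra.
From mathcomp Require Import all_classical all_reals all_analysis.
Set Implicit Arguments.
Unset Strict Implicit.
Unset Printing Implicit Defensive.
Import Order.TTheory GRing.Theory Num.Theory.
Import numFieldNormedType.Exports.
Local Open Scope classical_set_scope.
Local Open Scope ring_scope.

(* f (- m) + ... + f (-1) + f 0 + f 1 + ... + f n, with p = (m, n) *)
Definition bilateral_partial_sum (R : realType) (f : int -> R)
    (p : nat * nat) : R :=
  \sum_(0 <= i < (p.1 + p.2)%N.+1) f (i%:Z - p.1%:Z).

(* The two bounds go to infinity independently of each other, so that this is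
   not the weaker symmetric (principal value) summation. *)
Definition bilateral_cvg_to (R : realType) (f : int -> R) (s : R) : Prop :=
  bilateral_partial_sum f p @[p --> (\oo, \oo)] --> s.

Definition bilateral_sum (R : realType) (f : int -> R) : R :=
  lim (bilateral_partial_sum f p @[p --> (\oo, \oo)]).

(* Main.v *)
Require Import Defs.
From mathcomp Require Import all_boot all_order all_algebra.
From mathcomp Require Import all_classical all_reals all_analysis.
From mathcomp Require Import ring lra.
Set Implicit Arguments.
Unset Strict Implicit.
Unset Printing Implicit Defensive.
Import Order.TTheory GRing.Theory Num.Theory.
Import numFieldNormedType.Exports.
Local Open Scope classical_set_scope.
Local Open Scope ring_scope.

(** The function [f n = 1 / (n + 1/2)^3] is odd about the point [-1/2]:
    [f (- (k + 1)) = - f k].  Hence the negative half of a bilateral partial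
    sum is, up to sign, a partial sum of the positive half, and the sum of [f]
    from [- m] to [n] is the difference [S (n + 1) - S m], where [S] denotes
    the partial sums of the one-sided series [f 0 + f 1 + ...]
    ([bilateral_partial_sum_antisym]).  As soon as [S] has a finite limit, this
    difference tends to [0] when [m] and [n] go to infinity independently
    ([bilateral_cvg_to_antisym]).  Here [S] converges because it is
    nondecreasing and the telescoping series of [16 / ((k + 1) (k + 2))]
    dominates it ([is_cvg_half_cube_series]).  The value [0] is a root of
    ['X], thus algebraic. *)

Lemma bilateral_partial_sum_split (R : realType) (f : int -> R) (m n : nat) :
  bilateral_partial_sum f (m, n) =
  \sum_(0 <= k < m) f (- k.+1%:Z) + \sum_(0 <= k < n.+1) f k%:Z.
Proof.
rewrite /bilateral_partial_sum /= -addnS.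
rewrite (@big_cat_nat _ _ _ m) //= ?leq_addr //; congr (_ + _).
  rewrite big_nat_rev /=; apply: eq_big_nat => i /andP[_ im].
  by rewrite add0n -subzn // addrAC subrr add0r.
rewrite -{1}[m]add0n big_addn addKn; apply: eq_big_nat => i _.
by rewrite PoszD addrK.
Qed.

Lemma bilateral_partial_sum_antisym (R : realType) (f : int -> R) (m n : nat) :
  (forall k : nat, f (- k.+1%:Z) = - f k%:Z) ->
  bilateral_partial_sum f (m, n) =
  series (fun k => f k%:Z) n.+1 - series (fun k => f k%:Z) m.
Proof.
move=> f_anti; rewrite bilateral_partial_sum_split addrC /series /= -sumrN.
by congr (_ + _); apply: eq_bigr => k _.
Qed.

(** In [S n.+1 - S m] each term depends on one coordinate only and converges
    along it, both to the limit of [S]; hence the two bounds may grow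
    independently. *)
Lemma bilateral_cvg_to_antisym (R : realType) (f : int -> R) :
  (forall k : nat, f (- k.+1%:Z) = - f k%:Z) ->
  cvgn (series (fun k => f k%:Z)) ->
  bilateral_cvg_to f 0.
Proof.
move=> f_anti; set S := series _ => S_cvg; rewrite /bilateral_cvg_to.
have -> : bilateral_partial_sum f = fun p => S p.2.+1 - S p.1.
  by apply/funext => -[m n]; exact: bilateral_partial_sum_antisym.
rewrite -[0](subrr (limn S)); apply: cvgB.
  apply: (@cvg_comp _ _ _ snd (fun n => S n.+1) _ \oo); first exact: cvg_snd.
  by rewrite (cvg_shiftS S).
by apply: (@cvg_comp _ _ _ fst S _ \oo); first exact: cvg_fst.
Qed.

(** From [(x + 1) / 2 <= x + 1/2] the left side is at most [8 / (x + 1)^3], and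
    [x + 2 <= 2 (x + 1)^2] turns this into a telescoping bound. *)
Lemma half_cube_le_telescope (R : realFieldType) (x : R) : 0 <= x ->
  1 / (x + 1 / 2) ^+ 3 <= 16 / (x + 1) - 16 / (x + 2).
Proof.
move=> x0.
have -> : 16 / (x + 1) - 16 / (x + 2) = 16 / ((x + 1) * (x + 2)).
  by field; apply/andP; split; lra.
rewrite ler_pdivrMr; last by apply: exprn_gt0; lra.
rewrite mulrAC ler_pdivlMr; last by apply: mulr_gt0; lra.
by rewrite !exprS expr0; nra.
Qed.

Lemma is_cvg_half_cube_series (R : realType) :
  cvgn (series (fun k : nat => 1 / (k%:R + 1 / 2) ^+ 3 : R)).
Proof.
apply: nondecreasing_is_cvgn.
  apply: nondecreasing_series => k _ _.
  by apply: divr_ge0 => //; apply: exprn_ge0; have := ler0n R k; lra.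
exists 16 => _ [n _ <-].
suff : series (fun k : nat => 1 / (k%:R + 1 / 2) ^+ 3 : R) n
       <= 16 - 16 / (n%:R + 1).
  by move/le_trans; apply; rewrite gerBl divr_ge0 // addr_ge0.
rewrite /series /=; elim: n => [|n IHn].
  by rewrite big_geq // add0r divr1 subrr.
rewrite big_nat_recr //=.
have := half_cube_le_telescope (ler0n R n).
rewrite (_ : n.+1%:R + 1 = n%:R + 2 :> R); last by rewrite -natr1; lra.
lra.
Qed.

Theorem lemma1 (R : realType) :
  bilateral_cvg_to (fun n : int => 1 / (n%:~R + 1 / 2) ^+ 3 : R) 0 /\
  algebraicOver (ratr : rat -> R)
    (bilateral_sum (fun n : int => 1 / (n%:~R + 1 / 2) ^+ 3 : R)).
Proof.
have sum0 : bilateral_cvg_to (fun n : int => 1 / (n%:~R + 1 / 2) ^+ 3 : R) 0.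
  apply: bilateral_cvg_to_antisym; last exact: is_cvg_half_cube_series.
  move=> k; rewrite mulrNz -pmulrn -[k.+1]addn1 natrD.
  (* the reflection about -1/2 negates the base, and the cube is odd *)
  rewrite (_ : - (k%:R + 1%:R) + 1 / 2 = - (k%:R + 1 / 2) :> R); last by lra.
  by rewrite exprNn -signr_odd /= expr1 mulN1r invrN mulrN.
split=> //; rewrite /bilateral_sum (cvg_lim _ sum0) //.
by exists 'X; [rewrite polyX_eq0 | rewrite map_polyX rootX].
Qed.
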